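(* Let $R$ be a ring, $G$ a finite group acting on $R$, $H$ a subgroup of $G$, and $n\ge 0$ an integer. If the skew group ring $RG$ is a left $n$-perfect ring, then so is $RH$. Moreover, if $RG$ is a separable extension over $RH$, then $RG$ is a left $n$-perfect ring if and only if $RH$ is a left $n$-perfect ring.
   Context: Rings are associative with identity; modules are unitary and are left modules unless otherwise specified. $G$ acts on $R$ by ring automorphisms: $r\mapsto g(r)$ is a ring automorphism for each $g\in G$, $(g_1g_2)(r)=g_1(g_2(r))$ and $1(r)=r$. The skew group ring $RG$ is the free left $R$-module with basis $G$ and multiplication $(ag)(bh)=a\,g(b)\,gh$ for $a,b\in R$, $g,h\in G$. For a subgroup $H\le G$ (with the restricted action), $RH$ is a subring of $RG$. A ring $A$ is a separable extension over a subring $S$ if the multiplication map $A\otimes_S A\to A$, $a\otimes b\mapsto ab$, splits as a map of $A$-$A$-bimodules; i.e. there is $\sum_i a_i\otimes b_i\in A\otimes_S A$ with $\sum_i a_i\otimes b_i a=\sum_i a a_i\otimes b_i$ for all $a\in A$ and $\sum_i a_ib_i=1$. A ring $A$ is left $n$-perfect if every flat left $A$-module has projective dimension at most $n$. *)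

(* Defs.v *)
From HB Require Import structures.
From mathcomp Require Import all_boot all_order all_fingroup all_algebra.
From mathcomp Require Import boolp.
From mathcomp Require Import generic_quotient freeg.

Set Implicit Arguments.
Unset Strict Implicit.
Unset Printing Implicit Defensive.

Import GRing.Theory.
Local Open Scope ring_scope.
Local Open Scope quotient_scope.

(* An action of G on R by ring endomorphisms; the two laws make every         *)
(* [ract g] bijective, hence an automorphism.                                 *)
Record ring_action (G : finGroupType) (R : pzRingType) := RingAction {
  ract :> G -> {rmorphism R -> R};
  ract1 : forall r, ract 1%g r = r;
  ractM : forall g h r, ract (g * h)%g r = ract g (ract h r)
}.

Section RestrictAction.
Variables (G : finGroupType) (R : pzRingType) (act : ring_action G R).
Variable H : {group G}.

Definition res_fun (h : [subg H]) : {rmorphism R -> R} := act (sgval h).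

Fact res_fun1 r : res_fun 1%g r = r.
Proof. exact: ract1. Qed.

Fact res_funM g h r : res_fun (g * h)%g r = res_fun g (res_fun h r).
Proof. exact: ractM. Qed.

Definition res_action : ring_action [subg H] R := RingAction res_fun1 res_funM.

End RestrictAction.

(* f represents \sum_g (f g) g; the action only selects the multiplication.   *)
Definition skew_ring (G : finGroupType) (R : pzRingType)
    (act : ring_action G R) :=
  {ffun G -> R}.

Section SkewGroupRing.
Variables (G : finGroupType) (R : pzRingType) (act : ring_action G R).
Local Notation skew_ring := (skew_ring act).

HB.instance Definition _ := GRing.Zmodule.on skew_ring.

Definition monom (a : R) (g : G) : skew_ring :=
  [ffun x => if x == g then a else 0].

Definition skew_one : skew_ring := monom 1 1%g.

(* The coefficient at x collects the pairs (y, z) with y * z = x.             *)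
Definition skew_mul (f k : skew_ring) : skew_ring :=
  [ffun x => \sum_y f y * act y (k (y^-1 * x)%g)].

Fact skew_mulA : associative skew_mul.
Proof.
move=> f g h; apply/ffunP => x; rewrite !ffunE.
under eq_bigr => y _ do rewrite ffunE rmorph_sum mulr_sumr.
under [RHS]eq_bigr => y _ do rewrite ffunE mulr_suml.
rewrite [RHS]exchange_big /=; apply: eq_bigr => y _.
rewrite (reindex_inj (mulgI (y^-1)%g)) /=; apply: eq_bigr => z _.
by rewrite rmorphM -ractM mulgA mulgV mul1g mulrA invMg invgK -!mulgA mulKVg.
Qed.

Fact skew_mul1l : left_id skew_one skew_mul.
Proof.
move=> f; apply/ffunP => x; rewrite ffunE (bigD1 1%g) //= ffunE eqxx mul1r.
rewrite ract1 invg1 mul1g big1 ?addr0 // => y /negPf y1.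
by rewrite ffunE y1 mul0r.
Qed.

Fact skew_mul1r : right_id skew_one skew_mul.
Proof.
move=> f; apply/ffunP => x; rewrite ffunE (bigD1 x) //= ffunE mulVg eqxx.
rewrite rmorph1 mulr1 big1 ?addr0 // => y /negPf yx; rewrite ffunE.
by rewrite -(inj_eq (mulgI y)) mulKVg mulg1 eq_sym yx rmorph0 mulr0.
Qed.

Fact skew_mulDl : left_distributive skew_mul +%R.
Proof.
move=> f g h; apply/ffunP => x; rewrite !ffunE -big_split /=.
by apply: eq_bigr => y _; rewrite ffunE mulrDl.
Qed.

Fact skew_mulDr : right_distributive skew_mul +%R.
Proof.
move=> f g h; apply/ffunP => x; rewrite !ffunE -big_split /=.
by apply: eq_bigr => y _; rewrite ffunE rmorphD mulrDr.
Qed.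

HB.instance Definition _ := GRing.Zmodule_isPzRing.Build skew_ring
  skew_mulA skew_mul1l skew_mul1r skew_mulDl skew_mulDr.

Lemma monomM a b g h :
  monom a g * monom b h = monom (a * act g b) (g * h)%g.
Proof.
apply/ffunP => x; rewrite !ffunE (bigD1 g) //= !ffunE eqxx.
rewrite big1 ?addr0 => [|y /negPf yg]; last by rewrite ffunE yg mul0r.
have -> : ((g^-1 * x)%g == h) = (x == (g * h)%g).
  by rewrite -(inj_eq (mulgI g)) mulKVg.
by case: eqP => _; rewrite ?rmorph0 ?mulr0.
Qed.

End SkewGroupRing.

Section SkewInclusion.
Variables (G : finGroupType) (R : pzRingType) (act : ring_action G R).
Variable H : {group G}.

Definition skew_incl (f : skew_ring (res_action act H)) : skew_ring act :=
  [ffun g => if g \in H then f (subg H g) else 0].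

Fact skew_incl_zmod : zmod_morphism skew_incl.
Proof.
by move=> f k; apply/ffunP => x; rewrite !ffunE; case: ifP; rewrite ?subr0.
Qed.

Fact skew_incl_monoid : monoid_morphism skew_incl.
Proof.
split.
  apply/ffunP => x; rewrite !ffunE; case: ifPn => xH.
    by rewrite -(inj_eq subg_inj) /= subgK.
  by case: eqP xH => // ->; rewrite group1.
move=> f k; apply/ffunP => x; rewrite !ffunE.
rewrite [RHS](bigID [in H]) /= [X in _ + X]big1 ?addr0; last first.
  by move=> y /negPf yH; rewrite ffunE yH mul0r.
case: ifPn => xH; last first.
  rewrite big1 // => y yH.
  by rewrite !ffunE groupMl ?groupV // (negPf xH) rmorph0 mulr0.
rewrite [RHS](reindex_onto (@sgval _ H) (subg H)); last exact: subgK.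
apply: eq_big => [h|h _]; first by rewrite subgP sgvalK eqxx.
rewrite !ffunE subgP sgvalK groupMl ?groupV ?subgP // xH.
congr (_ * act _ (k _)); apply: subg_inj.
rewrite /= subgK ?groupM ?groupV ?subgP //.
by rewrite subgK // groupM ?groupV ?subgP.
Qed.

HB.instance Definition _ := GRing.isZmodMorphism.Build _ _ skew_incl
  skew_incl_zmod.
HB.instance Definition _ := GRing.isMonoidMorphism.Build _ _ skew_incl
  skew_incl_monoid.

Lemma skew_incl_inj : injective skew_incl.
Proof.
move=> f k /ffunP fk; apply/ffunP => h.
by have := fk (sgval h); rewrite !ffunE subgP sgvalK.
Qed.

End SkewInclusion.

Arguments skew_incl {G R} act H f.

(* The tensor product of a right S-module N and a left S-module M, presented  *)
(* as the free abelian group on N * M modulo the subgroup generated by        *)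
(* biadditivity and S-balancedness. The two actions are passed as functions   *)
(* so that a ring can be tensored over a subring without restricting scalars. *)
Section Tensor.
Variables (S : Type) (N M : zmodType).
Variables (actr : N -> S -> N) (actl : S -> M -> M).

Inductive tens_rel : {freeg (N * M) / int} -> Prop :=
| tens_rel0 : tens_rel 0
| tens_relB x y : tens_rel x -> tens_rel y -> tens_rel (x - y)
| tens_relDl n n' m :
    tens_rel (<< (n + n', m) >> - (<< (n, m) >> + << (n', m) >>))
| tens_relDr n m m' :
    tens_rel (<< (n, m + m') >> - (<< (n, m) >> + << (n, m') >>))
| tens_relA n s m : tens_rel (<< (actr n s, m) >> - << (n, actl s m) >>).

Definition tens_sub : {pred {freeg (N * M) / int}} :=
  fun x => `[< tens_rel x >].

Fact tens_sub_closed : zmod_closed tens_sub.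
Proof.
split=> [|x y /asboolP xS /asboolP yS]; apply/asboolP; first exact: tens_rel0.
exact: tens_relB.
Qed.

HB.instance Definition _ := GRing.isZmodClosed.Build _ tens_sub tens_sub_closed.

Definition tensor : Type := Quotient.quot tens_sub.

HB.instance Definition _ := EqQuotient.on tensor.
HB.instance Definition _ := GRing.Zmodule.on tensor.

Definition tens (n : N) (m : M) : tensor := \pi_tensor << (n, m) >>.

Fact tens_pi_eq x y : tens_rel (x - y) -> \pi_tensor x = \pi_tensor y.
Proof.
by move=> xy; apply/eqP; rewrite -Quotient.idealrBE; apply/asboolP.
Qed.

Lemma tensDl n n' m : tens (n + n') m = tens n m + tens n' m.
Proof. by rewrite /tens -[RHS]raddfD; apply/tens_pi_eq/tens_relDl. Qed.

Lemma tensDr n m m' : tens n (m + m') = tens n m + tens n m'.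
Proof. by rewrite /tens -[RHS]raddfD; apply/tens_pi_eq/tens_relDr. Qed.

Lemma tensA n s m : tens (actr n s) m = tens n (actl s m).
Proof. exact/tens_pi_eq/tens_relA. Qed.

Lemma tensNl n m : tens (- n) m = - tens n m.
Proof.
have t0 : tens 0 m = 0 by apply: (addrI (tens 0 m)); rewrite -tensDl !addr0.
by apply/eqP; rewrite -addr_eq0 -tensDl addNr t0.
Qed.

Lemma tens_span (x : tensor) :
  exists s : seq (N * M), x = \sum_(p <- s) tens p.1 p.2.
Proof.
pose Q y := exists s : seq (N * M), y = \sum_(p <- s) tens p.1 p.2.
have Q0 : Q 0 by exists [::]; rewrite big_nil.
have QD y z : Q y -> Q z -> Q (y + z).
  by move=> [s ->] [t ->]; exists (s ++ t); rewrite big_cat.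
have QN y : Q y -> Q (- y).
  move=> [s ->]; exists [seq (- p.1, p.2) | p <- s]; rewrite big_map -sumrN.
  by apply: eq_bigr => p _; rewrite tensNl.
have QMn y k : Q y -> Q (y *+ k).
  by move=> Qy; elim: k => [|k IH] //; rewrite mulrS; apply: QD.
rewrite -[x]reprK -[repr x]freeg_sumE raddf_sum; apply: (big_ind Q) => //.
move=> [n m] _; rewrite -[coeff _ _]intz -freegU_mulz raddfMz.
have Q1 : Q (tens n m) by exists [:: (n, m)]; rewrite big_seq1.
by case: (coeff _ _) => k; [apply: QMn | apply/QN/QMn].
Qed.

(* The map N (x) M -> Z induced by phi, computed on a representative of x: it *)
(* is meaningful only for biadditive balanced phi, see [tens_liftE].          *)
Definition tens_lift (Z : zmodType) (phi : N -> M -> Z) (x : tensor) : Z :=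
  fglift (fun p : N * M => phi p.1 p.2 : zmodule Z) (repr x).

Definition balanced (Z : zmodType) (phi : N -> M -> Z) :=
  [/\ forall n n' m, phi (n + n') m = phi n m + phi n' m,
      forall n m m', phi n (m + m') = phi n m + phi n m'
    & forall n s m, phi (actr n s) m = phi n (actl s m)].

Section Lift.
Variables (Z : zmodType) (phi : N -> M -> Z).
Hypothesis phiB : balanced phi.

Let F := fglift (fun p : N * M => phi p.1 p.2 : zmodule Z).

Let FB x y : F (x - y) = F x - F y.
Proof. exact: lift_is_additive. Qed.

Let F1 n m : F << (n, m) >> = phi n m.
Proof. by rewrite /F liftU scale1r. Qed.

Let FD x y : F (x + y) = F x + F y.
Proof.
have F0 : F 0 = 0 by rewrite -(subrr 0) FB subrr.
by rewrite -[y in LHS]opprK FB -[- y]add0r FB F0 sub0r opprK.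
Qed.

Fact tens_lift_pi x : tens_lift phi (\pi_tensor x) = F x.
Proof.
have FK y : tens_rel y -> F y = 0.
  case: phiB => phiDl phiDr phiA; elim=> {y}.
  - by rewrite -(subrr 0) FB subrr.
  - by move=> x' y _ xE _ yE; rewrite FB xE yE subr0.
  - by move=> n n' m; rewrite FB FD !F1 phiDl subrr.
  - by move=> n m m'; rewrite FB FD !F1 phiDr subrr.
  - by move=> n s m; rewrite FB !F1 phiA subrr.
apply/eqP; rewrite -subr_eq0 -FB; apply/eqP/FK/asboolP.
by have := Quotient.idealrBE tens_sub (repr (\pi_tensor x)) x; rewrite reprK eqxx.
Qed.

Lemma tens_liftE n m : tens_lift phi (tens n m) = phi n m.
Proof. by rewrite tens_lift_pi F1. Qed.

Lemma tens_lift_zmod : zmod_morphism (tens_lift phi).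
Proof.
move=> x y; rewrite -[x]reprK -[y]reprK -raddfB !tens_lift_pi.
exact: FB.
Qed.

End Lift.

End Tensor.

Section TensorMap.
Variables (S : Type) (N N' M M' : zmodType).
Variables (actr : N -> S -> N) (actl : S -> M -> M).
Variables (actr' : N' -> S -> N') (actl' : S -> M' -> M').

(* f (x) g, for S-linear f and g.                                             *)
Definition tens_map (f : N -> N') (g : M -> M') :
    tensor actr actl -> tensor actr' actl' :=
  tens_lift (fun n m => tens actr' actl' (f n) (g m)).

End TensorMap.

Arguments tens_map {S N N' M M' actr actl actr' actl'}.

Section Separable.
Variables (S A : pzRingType) (iota : {rmorphism S -> A}).

Definition tens_ext := tensor (fun a s => a * iota s) (fun s a => iota s * a).
Local Notation tensAA := (tens (fun a s => a * iota s) (fun s a => iota s * a)).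

HB.instance Definition _ := GRing.Zmodule.on tens_ext.

Definition ext_mul : tens_ext -> A := tens_lift (fun a b => a * b).
Definition ext_actl (a : A) : tens_ext -> tens_ext :=
  tens_map (fun x => a * x) id.
Definition ext_actr (a : A) : tens_ext -> tens_ext :=
  tens_map id (fun x => x * a).

Definition separable_ext :=
  exists sigma : {additive A -> tens_ext},
    [/\ forall a x, sigma (a * x) = ext_actl a (sigma x),
        forall x a, sigma (x * a) = ext_actr a (sigma x)
      & forall x, ext_mul (sigma x) = x].

Lemma separable_extP :
  separable_ext <->
  exists s : seq (A * A),
    (forall a, \sum_(p <- s) tensAA p.1 (p.2 * a) =
               \sum_(p <- s) tensAA (a * p.1) p.2) /\
    \sum_(p <- s) p.1 * p.2 = 1.
Proof.
have mulB : balanced (fun a s => a * iota s) (fun s a => iota s * a)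
    (fun a b : A => a * b).
  by split=> [? ? ?|? ? ?|? ? ?]; rewrite ?mulrDl ?mulrDr ?mulrA.
have lB c : balanced (fun a s => a * iota s) (fun s a => iota s * a)
    (fun a b : A => tensAA (c * a) b).
  by split=> [? ? ?|? ? ?|? ? ?]; rewrite ?mulrDr ?tensDl ?tensDr // mulrA tensA.
have rB c : balanced (fun a s => a * iota s) (fun s a => iota s * a)
    (fun a b : A => tensAA a (b * c)).
  by split=> [? ? ?|? ? ?|? ? ?];
    rewrite ?mulrDl ?tensDl ?tensDr // -mulrA tensA.
pose mulA := GRing.isZmodMorphism.Build _ _ ext_mul (tens_lift_zmod mulB).
pose lA c :=
  GRing.isZmodMorphism.Build _ _ (ext_actl c) (tens_lift_zmod (lB c)).
pose rA c :=
  GRing.isZmodMorphism.Build _ _ (ext_actr c) (tens_lift_zmod (rB c)).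
pose mulH : {additive tens_ext -> A} := HB.pack ext_mul mulA.
pose lH c : {additive tens_ext -> tens_ext} := HB.pack (ext_actl c) (lA c).
pose rH c : {additive tens_ext -> tens_ext} := HB.pack (ext_actr c) (rA c).
have mulE (s : seq (A * A)) (F1 F2 : A * A -> A) :
    ext_mul (\sum_(p <- s) tensAA (F1 p) (F2 p)) = \sum_(p <- s) F1 p * F2 p.
  apply: etrans (raddf_sum mulH _ _ _) _; apply: eq_bigr => p _; exact: tens_liftE.
have lE c (s : seq (A * A)) (F1 F2 : A * A -> A) :
    ext_actl c (\sum_(p <- s) tensAA (F1 p) (F2 p)) =
    \sum_(p <- s) tensAA (c * F1 p) (F2 p).
  apply: etrans (raddf_sum (lH c) _ _ _) _; apply: eq_bigr => p _.
  exact: (tens_liftE (lB c)).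
have rE c (s : seq (A * A)) (F1 F2 : A * A -> A) :
    ext_actr c (\sum_(p <- s) tensAA (F1 p) (F2 p)) =
    \sum_(p <- s) tensAA (F1 p) (F2 p * c).
  apply: etrans (raddf_sum (rH c) _ _ _) _; apply: eq_bigr => p _.
  exact: (tens_liftE (rB c)).
split=> [[sigma [sl sr sm]]|[s [sc s1]]].
  have [s sE] := tens_span (sigma 1); exists s; split=> [a|].
    by rewrite -rE -lE -sE -sl -sr mulr1 mul1r.
  by rewrite -mulE -sE sm.
pose f a : tens_ext := \sum_(p <- s) tensAA (a * p.1) p.2.
have fB : zmod_morphism f.
  move=> a b; rewrite /f -sumrB; apply: eq_bigr => p _.
  by rewrite mulrBl tensDl tensNl.
pose sigma : {additive A -> tens_ext} :=
  HB.pack f (GRing.isZmodMorphism.Build _ _ f fB).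
exists sigma; split=> [a x|x a|x] /=; rewrite /f.
- by rewrite lE; apply: eq_bigr => p _; rewrite mulrA.
- rewrite rE -(lE x s fst (fun p => p.2 * a)) sc lE.
  by apply: eq_bigr => p _; rewrite mulrA.
- rewrite mulE -[RHS]mulr1 -s1 mulr_sumr.
  by apply: eq_bigr => p _; rewrite mulrA.
Qed.

End Separable.

(* Right A-modules are left modules over the converse ring A^c.               *)
Definition tens_mod (A : pzRingType) (N : lmodType A^c) (M : lmodType A) :=
  @tensor A N M (fun n a => (a : A^c) *: n) (fun a m => a *: m).

Section ModuleNotions.
Variables (A : pzRingType).

Definition flat (M : lmodType A) :=
  forall (N N' : lmodType A^c) (f : {linear N -> N'}),
    injective f -> injective (tens_map f id : tens_mod N M -> tens_mod N' M).

Definition projective (P : lmodType A) :=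
  forall (B C : lmodType A) (p : {linear B -> C}) (f : {linear P -> C}),
    (forall c, exists b, p b = c) ->
    exists h : {linear P -> B}, forall x, p (h x) = f x.

Record projective_resolution (M : lmodType A) := ProjectiveResolution {
  res_obj : nat -> lmodType A;
  res_diff : forall i, {linear res_obj i.+1 -> res_obj i};
  res_aug : {linear res_obj 0 -> M};
  res_proj : forall i, projective (res_obj i);
  res_aug_surj : forall m, exists x, res_aug x = m;
  res_exact0 : forall x, res_aug x = 0 <-> exists y, res_diff 0 y = x;
  res_exactS : forall i x,
    res_diff i x = 0 <-> exists y, res_diff i.+1 y = x
}.

Definition proj_dim_le (n : nat) (M : lmodType A) :=
  exists P : projective_resolution M,
    forall i, (n < i)%N -> forall x : res_obj P i, x = 0.

End ModuleNotions.

Definition left_perfect (n : nat) (A : pzRingType) :=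
  forall M : lmodType A, flat M -> proj_dim_le n M.

(* Main.v *)
Require Import Defs.
From HB Require Import structures.
From mathcomp Require Import all_boot all_fingroup all_algebra.
From mathcomp Require Import boolp.

(* Let S = RH and A = RG. Representatives t_i of the right cosets of H, with  *)
(* the restriction map E : A -> S, make A a Frobenius extension of S that is  *)
(* free on both sides. Restriction along S -> A and (co)induction from S to A *)
(* are therefore exact, adjoint to each other on both sides, and preserve     *)
(* projectivity and flatness; hence neither increases projective dimension.   *)
(* Since E 1 = 1, every S-module M is a retract of the restriction of the     *)
(* module induced by M; if A is separable over S, every A-module M is a       *)
(* retract of the module induced by the restriction of M. As projective       *)
(* dimension does not increase under retracts, n-perfectness passes from A to *)
(* S, and in the separable case from S to A.                                  *)

Set Implicit Arguments.
Unset Strict Implicit.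
Unset Printing Implicit Defensive.

Import GRing.Theory.
Local Open Scope ring_scope.

(** For a flat [S]-module [M], the [A]-module [coind M] is flat ([coind_flat]), so it has projective
    dimension at most [n]. Restriction to [S] keeps this bound ([restr_pd_le]), and [M] is a retract
    of the restricted module ([retract_restr_coind]), so it inherits the bound by [pd_le_retract].
    The separable case runs the other way with [restr_flat], [coind_pd_le] and
    [retract_coind_restr]. All of this holds over any [frobenius] extension, with [F 1 = 1] for the
    descent to [S]; [skew_frobenius] is the only place where groups enter. Over such an extension
    the single functor [coind] is both Hom_S(A, -) and A (x)_S -, hence a right and a left adjoint
    of restriction. *)

Definition surj (U V : Type) (f : U -> V) := forall y, exists x, f x = y.

(** * Linear maps and kernels *)

Lemma ex_linear (A : pzRingType) (U V : lmodType A) (f : U -> V) :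
  linear f -> exists g : {linear U -> V}, g =1 f.
Proof.
move=> fL; pose g : {linear U -> V} :=
  HB.pack f (GRing.isLinear.Build _ _ _ _ f fL).
by exists g.
Qed.

(** Preimages under an injective [k] are unique, so any choice of them is automatically linear. *)
Lemma linear_factor (A : pzRingType) (X K P : lmodType A)
    (k : {linear K -> P}) (g : {linear X -> P}) :
  injective k -> (forall x, exists y, k y = g x) ->
  exists h : {linear X -> K}, forall x, k (h x) = g x.
Proof.
move=> kI kg; have [f fE] := choice kg.
have fL : linear f by move=> a x y; apply: kI; rewrite linearP !fE linearP.
by have [h hE] := ex_linear fL; exists h => x; rewrite hE.
Qed.

Section Kernel.
Variables (A : pzRingType) (U V : lmodType A) (f : {linear U -> V}).

Definition ker_pred : {pred U} := fun x => f x == 0.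

Fact ker_closed : submod_closed ker_pred.
Proof.
split=> [|a x y]; rewrite !unfold_in /ker_pred ?linear0 // => /eqP fx /eqP fy.
by rewrite linearP fx fy scaler0 addr0.
Qed.

HB.instance Definition _ := GRing.isSubmodClosed.Build A U ker_pred ker_closed.

Record kernel := Kernel { ker_val : U; _ : ker_val \in ker_pred }.

HB.instance Definition _ := [isSub for ker_val].
HB.instance Definition _ := [Choice of kernel by <:].
HB.instance Definition _ := [SubChoice_isSubLmodule of kernel by <:].

Lemma ker_valP (x : kernel) : f (\val x) = 0.
Proof. exact/eqP/(valP x). Qed.

Lemma ker_exact x : f x = 0 <-> exists y : kernel, \val y = x.
Proof.
split=> [fx0|[y <-]]; last exact: ker_valP.
have kx : x \in ker_pred by apply/eqP.
by exists (Kernel kx).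
Qed.

End Kernel.

(** * Projective dimension by short exact sequences, and its behaviour under retracts *)

Section ProjectiveDimension.
Variable A : pzRingType.
Implicit Types M L P Q K : lmodType A.

Definition retract M L :=
  exists (i : {linear M -> L}) (r : {linear L -> M}), forall x, r (i x) = x.

Definition short_exact K P M (k : {linear K -> P}) (p : {linear P -> M}) :=
  [/\ injective k, surj p & forall x, p x = 0 <-> exists y, k y = x].

Lemma ker_short_exact P M (p : {linear P -> M}) :
  surj p -> exists k : {linear kernel p -> P}, short_exact k p.
Proof.
move=> pS.
exists (GRing.Linear.clone _ _ _ _ (\val : kernel p -> P) _); split => //.
- exact: val_inj.
- exact: ker_exact.
Qed.

Lemma projective_retract M L : retract M L -> projective L -> projective M.
Proof.
move=> [i [r ri]] pL B C p f pS.
have [h hE] := pL B C p (f \o r) pS.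
by exists (h \o i) => x /=; rewrite hE /= ri.
Qed.

Lemma projective_prod P Q :
  projective P -> projective Q -> projective (P * Q)%type.
Proof.
move=> pP pQ B C p f pS.
have [i iE] : exists i : {linear P -> (P * Q)%type}, forall x, i x = (x, 0).
  apply: ex_linear => a x y; congr pair => /=; by rewrite scaler0 addr0.
have [j jE] : exists j : {linear Q -> (P * Q)%type}, forall x, j x = (0, x).
  apply: ex_linear => a x y; congr pair => /=; by rewrite scaler0 addr0.
have [h hE] := pP B C p (f \o i) pS; have [g gE] := pQ B C p (f \o j) pS.
have [l lE] : exists l : {linear (P * Q)%type -> B},
    forall x, l x = h x.1 + g x.2.
  apply: ex_linear => a x y /=; by rewrite !linearP scalerDr addrACA.
exists l => -[x y]; rewrite lE linearD hE gE /= -linearD iE jE.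
by congr (f _); congr pair => /=; rewrite ?addr0 ?add0r.
Qed.

(** Projective dimension by iterated syzygies, a form suited to induction on [n]; [proj_dim_leP]
    identifies it with the definition by resolutions. *)
Fixpoint pd_le n M : Prop :=
  if n is n'.+1 then
    exists (P K : lmodType A) (k : {linear K -> P}) (p : {linear P -> M}),
      [/\ projective P, short_exact k p & pd_le n' K]
  else projective M.

(** The projective factor is absorbed into the first term of a resolution of [N]; the syzygy [K]
    does not change. *)
Lemma pd_le_prod n N P : pd_le n N -> projective P -> pd_le n (N * P)%type.
Proof.
case: n => [|n] /=; first exact: projective_prod.
move=> [Q [K [k [p [pQ [kI pS pE] dK]]]]] pP.
have [k' k'E] : exists k' : {linear K -> (Q * P)%type},
    forall x, k' x = (k x, 0).
  by apply: ex_linear => a x y; congr pair => /=;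
    rewrite ?linearP // scaler0 addr0.
have [p' p'E] : exists p' : {linear (Q * P)%type -> (N * P)%type},
    forall x, p' x = (p x.1, x.2).
  by apply: ex_linear => a x y; congr pair => /=; rewrite ?linearP.
exists (Q * P)%type, K, k', p'; split=> //; first exact: projective_prod.
split=> [x y|[x y]|[x y]]; first by rewrite !k'E => -[/kI].
- by have [z <-] := pS x; exists (z, y); rewrite p'E.
- rewrite p'E /=; split=> [[/pE [z <-] ->]|[z]]; first by exists z; rewrite k'E.
  by rewrite k'E => -[<- <-]; congr pair; apply/pE; exists z.
Qed.

(* If [r : L -> M] is a retraction and [p : P -> L] is onto with [P]          *)
(* projective and kernel [N], then [r \o p] maps [P] onto [M] and its kernel  *)
(* is a retract of [N * P]: this replaces Schanuel's lemma.                   *)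
Lemma pd_le_retract n M L : retract M L -> pd_le n L -> pd_le n M.
Proof.
elim: n M L => [|n IH] M L; first exact: projective_retract.
move=> [i [r ri]] [P [N [k [p [pP [kI pS pE] dN]]]]].
have rpS : surj (r \o p).
  by move=> y; have [z pz] := pS (i y); exists z; rewrite /= pz ri.
have [v [vI _ vE]] := ker_short_exact rpS.
exists P, (kernel (r \o p)), v, (r \o p); split=> //.
apply: (IH _ (N * P)%type); last exact: pd_le_prod.
(* [e] lifts the idempotent [i \o r] of [L] along [p], so [p \o e] is [i \o r \o p]. *)
have [e eE] := pP _ _ p (i \o (r \o p)) pS.
have vK z : r (p (v z)) = 0 by apply/vE; exists z.
have [f fE] : exists f : {linear kernel (r \o p) -> N},
    forall z, k (f z) = e (v z).
  apply: (@linear_factor _ _ _ _ k (e \o v)) kI _ => z.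
  by apply/pE; rewrite eE /= vK linear0.
(* [r \o p] kills [z - e z] because [r \o i] is the identity; on the kernel of [r \o p], [e] takes
   values in the image of [k]. Hence [(f z, v z)] is sent back to [v z]. *)
have [g gE] : exists g : {linear (N * P)%type -> P},
    forall z, g z = k z.1 + (z.2 - e z.2).
  apply: ex_linear => a x y /=; rewrite !linearP.
  by rewrite [X in _ + X]addrACA -!scalerDr addrACA -scalerDr.
have [h hE] : exists h : {linear (N * P)%type -> kernel (r \o p)},
    forall z, v (h z) = g z.
  apply: linear_factor vI _ => z; apply/vE; rewrite gE /= !linearD /=.
  have -> : p (k z.1) = 0 by apply/pE; exists z.1.
  by rewrite linear0 add0r !linearN /= eE /= ri subrr.
have [j jE] : exists j : {linear kernel (r \o p) -> (N * P)%type},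
    forall z, j z = (f z, v z).
  by apply: ex_linear => a x y; congr pair => /=; rewrite linearP.
by exists j, h => z; apply: vI; rewrite hE gE jE /= fE addrC subrK.
Qed.

Lemma retract_bij M L (f : {linear M -> L}) :
  injective f -> surj f -> retract L M.
Proof.
move=> fI fS; have [g gE] := @linear_factor _ L M L f idfun fI fS.
by exists g, f => x; rewrite gE.
Qed.

Lemma proj_dim_leP n M : proj_dim_le n M <-> pd_le n M.
Proof.
split.
  elim: n M => [|n IH] M [[P d e pP eS e0 dE]] /= P0.
    (* With no terms in positive degree, the augmentation is an isomorphism. *)
    apply: (projective_retract _ (pP 0%N)); apply: (retract_bij _ eS).
    apply: raddf_inj => x /e0 [y <-]; by rewrite (P0 1%N isT y) linear0.
  have [v [vI _ vE]] := ker_short_exact eS.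
  exists (P 0%N), (kernel e), v, e; split=> //; apply: IH.
  have [d0 d0E] : exists d0 : {linear P 1%N -> kernel e},
      forall x, v (d0 x) = d 0%N x.
    by apply: linear_factor vI _ => x; apply/vE/e0; exists x.
  (* Dropping degree 0 leaves a resolution of the first syzygy, augmented by [d 0] with its codomain
     restricted to the kernel of [e]. *)
  unshelve eexists (@ProjectiveResolution A (kernel e) (fun i => P i.+1)
    (fun i => d i.+1) d0 _ _ _ _) => //=.
  - move=> y; have /e0 [x xE] : e (v y) = 0 by apply/vE; exists y.
    by exists x; apply: vI; rewrite d0E.
  - move=> x; rewrite -dE -d0E; split=> [->|]; first exact: linear0.
    by rewrite -{1}(linear0 v) => /vI.
  - by move=> i; apply: dE.
  - by move=> i ni; exact: (P0 i.+1 ni).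
elim: n M => [|n IH] M /=.
  (* Functions on the empty type ['I_0] serve as the zero module in positive degrees. *)
  move=> pM; pose Z : lmodType A := {ffun 'I_0 -> A^o}.
  have Z0 (x : Z) : x = 0 by apply/ffunP => -[].
  pose P i : lmodType A := if i is 0 then M else Z.
  pose d i : {linear P i.+1 -> P i} := \0.
  unshelve eexists (@ProjectiveResolution A M P d idfun _ _ _ _).
  - case=> [|i] //= B C p f _; exists (\0) => x.
    by rewrite (Z0 x) !linear0.
  - by move=> m; exists m.
  - by move=> x /=; split=> [->|[y <-]] //=; exists 0.
  - by move=> i x; split=> [_|_] //; exists 0; rewrite [RHS]Z0.
  - by case.
move=> [P [K [k [p [pP [kI pS pE] /IH [[Q d e pQ eS e0 dE] Q0]]]]]].
(* The resolution of [K] is spliced onto [P] through [k \o e]. *)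
pose Q' i : lmodType A := if i is j.+1 then Q j else P.
pose d' i : {linear Q' i.+1 -> Q' i} :=
  if i is j.+1 then d j else GRing.Linear.clone _ _ _ _ (k \o e) _.
unshelve eexists (@ProjectiveResolution A M Q' d' p _ _ _ _) => //.
- by case.
- move=> x; rewrite pE; split=> [[y <-]|[y <-]]; last by exists (e y).
  by have [z <-] := eS y; exists z.
- case=> [|i] x; last exact: dE.
  apply: iff_trans (e0 x) => /=; split=> [|->]; last exact: linear0.
  by rewrite -(linear0 k) => /kI.
- by case=> // i ni; exact: (Q0 i ni).
Qed.

End ProjectiveDimension.

(** * Restriction of scalars *)

Definition restr (S A : pzRingType) (iota : {rmorphism S -> A})
    (M : lmodType A) : Type := M.

Section Restriction.
Variables (S A : pzRingType) (iota : {rmorphism S -> A}).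

Section Module.
Variable M : lmodType A.

Local Notation restr := (restr iota M).

HB.instance Definition _ := GRing.Zmodule.on restr.

Definition restr_scale (s : S) (m : restr) : restr := iota s *: (m : M).

Fact restr_scaleA a b m :
  restr_scale a (restr_scale b m) = restr_scale (a * b) m.
Proof. by rewrite /restr_scale scalerA rmorphM. Qed.

Fact restr_scale1 : left_id 1 restr_scale.
Proof. by move=> m; rewrite /restr_scale rmorph1 scale1r. Qed.

Fact restr_scaleDr : right_distributive restr_scale +%R.
Proof. by move=> a x y; rewrite /restr_scale scalerDr. Qed.

Fact restr_scaleDl m : {morph restr_scale^~ m : a b / a + b}.
Proof. by move=> a b; rewrite /restr_scale rmorphD scalerDl. Qed.

HB.instance Definition _ := GRing.Zmodule_isLmodule.Build S restr
  restr_scaleA restr_scale1 restr_scaleDr restr_scaleDl.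

Lemma restr_scaleE (s : S) (m : restr) : s *: m = iota s *: (m : M).
Proof. by []. Qed.

End Module.

Definition restr_map (M N : lmodType A) (f : {linear M -> N}) :
    restr iota M -> restr iota N := f.

Lemma restr_map_linear (M N : lmodType A) (f : {linear M -> N}) :
  linear (restr_map f).
Proof. by move=> a x y; rewrite !restr_scaleE /restr_map linearP. Qed.

HB.instance Definition _ (M N : lmodType A) (f : {linear M -> N}) :=
  GRing.isLinear.Build S (restr iota M) (restr iota N) _ (restr_map f)
    (restr_map_linear f).

End Restriction.

Arguments restr_map {S A} iota {M N} f.

(* A free Frobenius extension with trivial Gram matrix: [A] is a free left    *)
(* [S]-module on the [fr_t i], with coordinate functions                      *)
(* [a |-> fr_E (a * fr_u i)], and a free right one on the [fr_u i], with      *)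
(* coordinate functions [a |-> fr_E (fr_t i * a)]. The notion is stable under *)
(* passing to converse rings.                                                 *)
Record frobenius (S A : pzRingType) (iota : {rmorphism S -> A}) := Frobenius {
  fr_idx : finType;
  fr_E :> {additive A -> S};
  fr_t : fr_idx -> A;
  fr_u : fr_idx -> A;
  fr_El : forall s a, fr_E (iota s * a) = s * fr_E a;
  fr_Er : forall a s, fr_E (a * iota s) = fr_E a * s;
  fr_Gram : forall i j, fr_E (fr_t i * fr_u j) = (i == j)%:R;
  fr_tE : forall a, \sum_i iota (fr_E (a * fr_u i)) * fr_t i = a;
  fr_uE : forall a, \sum_i fr_u i * iota (fr_E (fr_t i * a)) = a
}.

(** * Frobenius data for the converse rings, which carry over to right modules *)

Section Converse.
Variables (S A : pzRingType) (iota : {rmorphism S -> A}).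

Definition conv_fun (s : S^c) : A^c := iota s.

Fact conv_fun_zmod : zmod_morphism conv_fun.
Proof. by move=> x y; apply: (raddfB iota). Qed.

Fact conv_fun_monoid : monoid_morphism conv_fun.
Proof. by split=> [|x y]; [exact: (rmorph1 iota) | exact: (rmorphM iota)]. Qed.

HB.instance Definition _ :=
  GRing.isZmodMorphism.Build _ _ conv_fun conv_fun_zmod.
HB.instance Definition _ :=
  GRing.isMonoidMorphism.Build _ _ conv_fun conv_fun_monoid.

Definition conv_morph : {rmorphism S^c -> A^c} := conv_fun.

Variable F : frobenius iota.

Definition conv_E (a : A^c) : S^c := F a.

Fact conv_E_zmod : zmod_morphism conv_E.
Proof. by move=> x y; apply: (raddfB F). Qed.

HB.instance Definition _ := GRing.isZmodMorphism.Build _ _ conv_E conv_E_zmod.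

(** Reversing multiplication exchanges the two bases, and with them the left and right axioms. *)
Definition frobenius_conv : frobenius conv_morph.
Proof.
apply: (@Frobenius S^c A^c conv_morph (fr_idx F) conv_E
  (@fr_u _ _ _ F) (@fr_t _ _ _ F)).
- by move=> s a; apply: (fr_Er F).
- by move=> a s; apply: (fr_El F).
- by move=> i j; rewrite eq_sym; exact: (fr_Gram j i).
- exact: (fr_uE F).
- exact: (fr_tE F).
Defined.

End Converse.

(** * Coinduction, which is also induction, along a Frobenius extension *)

Section Coinduction.
Variables (S A : pzRingType) (iota : {rmorphism S -> A}) (F : frobenius iota).
Local Notation t := (@fr_t _ _ _ F).
Local Notation u := (@fr_u _ _ _ F).
Local Notation I := (fr_idx F).

(** The matrices of right multiplication in the basis [t] multiply like the elements of [A]: the sum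
    over [l] expands [b * u j] in the basis [u]. *)
Lemma fr_mx a b i j :
  \sum_l F (t i * a * u l) * F (t l * b * u j) = F (t i * (a * b) * u j).
Proof.
under eq_bigr => l _ do rewrite -fr_Er -[_ * u l * _]mulrA -[t l * b * _]mulrA.
by rewrite -raddf_sum -mulr_sumr fr_uE !mulrA.
Qed.

Section Module.
Variable M : lmodType S.

(* [k] stands for the [S]-linear map [A -> M] with [t i |-> k i].             *)
Definition coind : Type := {ffun I -> M}.

HB.instance Definition _ := GRing.Zmodule.on coind.

(** This is the action on Hom_S(A, M) where [a] sends a map phi to x |-> phi(x a), since [t i * a]
    has coordinates [F (t i * a * u j)] in the basis [t]. *)
Definition coind_scale (a : A) (k : coind) : coind :=
  [ffun i => \sum_j F (t i * a * u j) *: k j].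

Fact coind_scaleA a b k :
  coind_scale a (coind_scale b k) = coind_scale (a * b) k.
Proof.
apply/ffunP => i; rewrite !ffunE.
under eq_bigr => l _ do rewrite ffunE scaler_sumr.
rewrite exchange_big /=; apply: eq_bigr => j _.
by rewrite -fr_mx scaler_suml; apply: eq_bigr => l _; rewrite scalerA.
Qed.

Fact coind_scale1 : left_id 1 coind_scale.
Proof.
move=> k; apply/ffunP => i; rewrite ffunE (bigD1 i) //= mulr1 fr_Gram eqxx.
rewrite scale1r big1 ?addr0 // => j ji.
by rewrite fr_Gram eq_sym (negPf ji) scale0r.
Qed.

Fact coind_scaleDr : right_distributive coind_scale +%R.
Proof.
move=> a k l; apply/ffunP => i; rewrite !ffunE -big_split /=.
by apply: eq_bigr => j _; rewrite ffunE scalerDr.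
Qed.

Fact coind_scaleDl k : {morph coind_scale^~ k : a b / a + b}.
Proof.
move=> a b; apply/ffunP => i; rewrite !ffunE -big_split /=.
by apply: eq_bigr => j _; rewrite mulrDr mulrDl raddfD scalerDl.
Qed.

HB.instance Definition _ := GRing.Zmodule_isLmodule.Build A coind
  coind_scaleA coind_scale1 coind_scaleDr coind_scaleDl.

Lemma coind_scaleE a (k : coind) i :
  (a *: k) i = \sum_j F (t i * a * u j) *: k j.
Proof. by rewrite ffunE. Qed.

Lemma coind_addE (k l : coind) i : (k + l) i = k i + l i.
Proof. by rewrite ffunE. Qed.

Lemma coind_sumE (J : finType) (k : J -> coind) i :
  (\sum_j k j) i = \sum_j k j i.
Proof. exact: sum_ffunE. Qed.

(** In Hom_S(A, M) this is the map a |-> F(a) m; in A (x)_S M it is 1 (x) m. *)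
Definition coind_unit (m : M) : coind := [ffun i => F (t i) *: m].
(** Evaluation of a map A -> M at 1, whose coordinates in the basis [t] are [F (u i)]. *)
Definition coind_counit (k : coind) : M := \sum_i F (u i) *: k i.

Lemma coind_unit_linear : linear (coind_unit : M -> restr iota coind).
Proof.
move=> s m n; apply/ffunP => i.
rewrite coind_addE !ffunE scalerDr; congr (_ + _).
rewrite scalerA -fr_Er -{1}(fr_tE F (t i * iota s)) raddf_sum scaler_suml.
by apply: eq_bigr => j _; rewrite fr_El ffunE scalerA.
Qed.

Lemma coind_unitD m n : coind_unit (m + n) = coind_unit m + coind_unit n.
Proof. by have := coind_unit_linear 1 m n; rewrite !scale1r. Qed.

Lemma coind_unitZ s m : coind_unit (s *: m) = iota s *: coind_unit m.
Proof.
have U0 : coind_unit 0 = 0 by apply/ffunP => i; rewrite !ffunE scaler0.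
by have := coind_unit_linear s m 0; rewrite addr0 U0 addr0.
Qed.

Lemma coind_counit_linear : linear (coind_counit : restr iota coind -> M).
Proof.
move=> s k l; rewrite /coind_counit scaler_sumr.
under eq_bigr => i _ do rewrite coind_addE scalerDr restr_scaleE coind_scaleE.
rewrite big_split /=; congr (_ + _).
under eq_bigr => i _ do rewrite scaler_sumr.
rewrite exchange_big /=; apply: eq_bigr => j _; rewrite scalerA -fr_El.
under eq_bigr => i _ do rewrite scalerA -fr_Er -mulrA.
by rewrite -scaler_suml -raddf_sum fr_uE.
Qed.

Lemma coind_unit_scale a m i : (a *: coind_unit m) i = F (t i * a) *: m.
Proof.
rewrite coind_scaleE -{2}(fr_tE F (t i * a)) raddf_sum scaler_suml.
by apply: eq_bigr => j _; rewrite ffunE fr_El scalerA.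
Qed.

(** This identifies [coind M] with A (x)_S M, [k] being the sum of the u_i (x) k_i. *)
Lemma coind_decomp (k : coind) : k = \sum_i u i *: coind_unit (k i).
Proof.
apply/ffunP => j; rewrite coind_sumE (bigD1 j) //=.
rewrite coind_unit_scale fr_Gram eqxx scale1r big1 ?addr0 // => i ij.
by rewrite coind_unit_scale fr_Gram eq_sym (negPf ij) scale0r.
Qed.

(** The map a |-> F(a) m is evaluated at 1. *)
Lemma coind_unitK m : coind_counit (coind_unit m) = F 1 *: m.
Proof.
rewrite -(fr_uE F 1) raddf_sum scaler_suml; apply: eq_bigr => i _.
by rewrite ffunE scalerA fr_Er mulr1.
Qed.

End Module.

Definition coind_map (M N : lmodType S) (f : {linear M -> N})
    (k : coind M) : coind N :=
  [ffun i => f (k i)].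

Lemma coind_map_linear (M N : lmodType S) (f : {linear M -> N}) :
  linear (coind_map f).
Proof.
move=> a k l; apply/ffunP => i; rewrite coind_addE coind_scaleE.
rewrite ffunE coind_addE coind_scaleE linearD linear_sum !ffunE; congr (_ + _).
by apply: eq_bigr => j _; rewrite linearZ ffunE.
Qed.

HB.instance Definition _ (M N : lmodType S) (f : {linear M -> N}) :=
  GRing.isLinear.Build A (coind M) (coind N) _ (coind_map f)
    (coind_map_linear f).

Lemma coind_map_inj (M N : lmodType S) (f : {linear M -> N}) :
  injective f -> injective (coind_map f).
Proof.
move=> fI k l /ffunP kl; apply/ffunP => i; apply: fI.
by move: (kl i); rewrite !ffunE.
Qed.

Lemma coind_map_surj (M N : lmodType S) (f : {linear M -> N}) :
  surj f -> surj (coind_map f).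
Proof.
move=> /choice [g gK] k; exists [ffun i => g (k i)].
by apply/ffunP => i; rewrite !ffunE gK.
Qed.

Section AModule.
Variable M : lmodType A.

(** The transpose of [f] when [coind] is right adjoint to restriction: m goes to the map a |-> f(a
    m). *)
Lemma coind_curry_linear (N : lmodType S) (f : {linear restr iota M -> N}) :
  linear (fun m : M => [ffun i => f (t i *: m)] : coind N).
Proof.
move=> a m n; apply/ffunP => i; rewrite coind_addE coind_scaleE !ffunE.
rewrite scalerDr linearD; congr (_ + _).
rewrite scalerA -{1}(fr_tE F (t i * a)) scaler_suml linear_sum.
apply: eq_bigr => j _; rewrite ffunE -scalerA; exact: linearZ.
Qed.

(** The transpose of [f] when [coind] is left adjoint to restriction: a (x) n goes to a f(n). *)
Lemma coind_eval_linear (N : lmodType S) (f : {linear N -> restr iota M}) :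
  linear (fun k : coind N => \sum_i u i *: (f (k i) : M)).
Proof.
move=> a k l; rewrite scaler_sumr.
under eq_bigr => i _ do rewrite coind_addE linearD scalerDr coind_scaleE.
rewrite big_split /=; congr (_ + _).
under eq_bigr => i _ do rewrite linear_sum scaler_sumr.
rewrite exchange_big /=; apply: eq_bigr => j _.
rewrite scalerA -(fr_uE F (a * u j)) scaler_suml; apply: eq_bigr => i _.
by rewrite linearZ /= restr_scaleE scalerA mulrA.
Qed.

End AModule.

(** * Restriction and coinduction preserve projectivity and bounds on projective dimension *)

(** The right adjoint [coind] preserves surjections, so the transpose of [f] lifts; evaluating the
    lift at 1 transposes it back. *)
Lemma restr_projective (P : lmodType A) :
  projective P -> projective (restr iota P).
Proof.
move=> pP B C p f pS; have [f' f'E] := ex_linear (coind_curry_linear f).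
have [h hE] := pP _ _ (coind_map p) f' (coind_map_surj pS).
have hL : linear (fun x : restr iota P => coind_counit (h x)).
  by move=> s x y; rewrite restr_scaleE linearP; apply: coind_counit_linear.
have [g gE] := ex_linear hL; exists g => x; rewrite gE /coind_counit linear_sum.
transitivity (\sum_i F (u i) *: f' x i).
  by apply: eq_bigr => i _; rewrite linearZ -hE ffunE.
under eq_bigr => i _ do rewrite f'E ffunE -linearZ restr_scaleE scalerA.
rewrite -linear_sum; congr (f _).
transitivity ((\sum_i iota (F (1 * u i)) * t i) *: (x : P)).
  by rewrite scaler_suml; apply: eq_bigr => i _; rewrite mul1r.
by rewrite fr_tE scale1r.
Qed.

(** Here [coind] is the left adjoint, and restriction preserves surjections. *)
Lemma coind_projective (P : lmodType S) : projective P -> projective (coind P).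
Proof.
move=> pP B C p f pS.
have fL : linear (fun x : P => f (coind_unit x) : restr iota C).
  by move=> s x y; rewrite coind_unit_linear restr_scaleE linearP.
have [f' f'E] := ex_linear fL.
have [h hE] := pP (restr iota B) (restr iota C) (restr_map iota p) f' pS.
have [g gE] := ex_linear (coind_eval_linear h); exists g => k.
rewrite gE linear_sum [k in RHS]coind_decomp linear_sum.
by apply: eq_bigr => i _; rewrite linearZ /= [p _]hE f'E linearZ.
Qed.

Lemma restr_pd_le n (M : lmodType A) : pd_le n M -> pd_le n (restr iota M).
Proof.
elim: n M => [|n IH] M /=; first exact: restr_projective.
move=> [P [K [k [p [pP [kI pS pE] dK]]]]].
exists (restr iota P), (restr iota K), (restr_map iota k), (restr_map iota p).
by split; [exact: restr_projective | split | exact: IH].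
Qed.

Lemma coind_pd_le n (M : lmodType S) : pd_le n M -> pd_le n (coind M).
Proof.
elim: n M => [|n IH] M /=; first exact: coind_projective.
move=> [P [K [k [p [pP [kI pS pE] dK]]]]].
exists (coind P), (coind K), (coind_map k), (coind_map p).
split; [exact: coind_projective | | exact: IH].
split; [exact: coind_map_inj | exact: coind_map_surj | move=> f].
split=> [/ffunP f0|[g <-]].
  have /choice [g gE] i : exists y, k y = f i.
    by apply/pE; have := f0 i; rewrite !ffunE.
  by exists [ffun i => g i]; apply/ffunP => i; rewrite !ffunE gE.
by apply/ffunP => i; rewrite !ffunE; apply/pE; exists (g i).
Qed.

Lemma retract_restr_coind (M : lmodType S) :
  F 1 = 1 -> retract M (restr iota (coind M)).
Proof.
move=> F1; have [i iE] := ex_linear (@coind_unit_linear M).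
have [r rE] := ex_linear (@coind_counit_linear M).
by exists i, r => x; rewrite rE iE coind_unitK F1 scale1r.
Qed.

End Coinduction.

Arguments coind_map {S A iota} F {M N} f.

(** * Additive maps out of tensor products *)

Section TensorMorphisms.
Variables (S : Type) (N M : zmodType).
Variables (actr : N -> S -> N) (actl : S -> M -> M).

Lemma ex_tens_lift (Z : zmodType) (phi : N -> M -> Z) :
  balanced actr actl phi ->
  exists f : {additive tensor actr actl -> Z},
    forall n m, f (tens _ _ n m) = phi n m.
Proof.
move=> phiB; pose f : {additive tensor actr actl -> Z} :=
  HB.pack (tens_lift phi)
    (GRing.isZmodMorphism.Build _ _ _ (tens_lift_zmod phiB)).
by exists f => n m; apply: tens_liftE.
Qed.

Lemma tens_ext_eq (Z : zmodType) (f g : {additive tensor actr actl -> Z}) :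
  (forall n m, f (tens _ _ n m) = g (tens _ _ n m)) -> f =1 g.
Proof.
move=> fg x; have [s ->] := tens_span x; rewrite !raddf_sum.
by apply: eq_bigr => p _.
Qed.

Lemma tens_cancel (Z : zmodType) (f : {additive tensor actr actl -> Z})
    (g : {additive Z -> tensor actr actl}) :
  (forall n m, g (f (tens _ _ n m)) = tens _ _ n m) -> cancel f g.
Proof. by move=> gf; apply: (tens_ext_eq (f := g \o f) (g := idfun)). Qed.

Lemma tens_sumr n (J : finType) (m : J -> M) :
  tens actr actl n (\sum_j m j) = \sum_j tens actr actl n (m j).
Proof.
have D : zmod_morphism (tens actr actl n).
  by move=> x y; apply/eqP; rewrite eq_sym subr_eq -tensDr subrK.
pose f : {additive M -> _} :=
  HB.pack (tens actr actl n) (GRing.isZmodMorphism.Build _ _ _ D).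
exact: (raddf_sum f).
Qed.

Lemma tens_suml (J : finType) (n : J -> N) m :
  tens actr actl (\sum_j n j) m = \sum_j tens actr actl (n j) m.
Proof.
have D : zmod_morphism (fun n => tens actr actl n m).
  by move=> x y; rewrite tensDl tensNl.
pose f : {additive N -> _} :=
  HB.pack (fun n => tens actr actl n m)
    (GRing.isZmodMorphism.Build _ _ _ D).
exact: (raddf_sum f).
Qed.

End TensorMorphisms.

Local Notation balanced_mod A N M phi :=
  (@balanced A N M (fun n a => (a : A^c) *: n) (fun a m => a *: m) _ phi).

Lemma ex_tens_mod_map (A : pzRingType) (M : lmodType A) (N N' : lmodType A^c)
    (f : {linear N -> N'}) :
  exists g : {additive tens_mod N M -> tens_mod N' M},
    g =1 (tens_map f id : tens_mod N M -> tens_mod N' M) /\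
    forall n m, g (tens _ _ n m) = tens _ _ (f n) m.
Proof.
have fB : balanced_mod A N M (fun n m => tens _ _ (f n) m : tens_mod N' M).
  split=> [n n' m|n m m'|n a m]; first by rewrite linearD tensDl.
    exact: tensDr.
  by rewrite linearZ tensA.
have [g gE] := ex_tens_lift fB; exists g; split=> //.
pose h : {additive tens_mod N M -> tens_mod N' M} :=
  HB.pack (tens_map f id : tens_mod N M -> tens_mod N' M)
    (GRing.isZmodMorphism.Build _ _ _ (tens_lift_zmod fB)).
by apply: (tens_ext_eq (g := h)) => n m; rewrite gE; apply/esym/(tens_liftE fB).
Qed.

(** * Restriction and coinduction preserve flatness *)

Section Flat.
Variables (S A : pzRingType) (iota : {rmorphism S -> A}) (F : frobenius iota).
Local Notation t := (@fr_t _ _ _ F).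
Local Notation u := (@fr_u _ _ _ F).

Let Fc : frobenius (conv_morph iota) := frobenius_conv F.

(* As [coind M] is [A (x)_S M], this is [N (x)_A (A (x)_S M) -> N (x)_S M].   *)
Lemma coind_tens_restr (M : lmodType S) (N : lmodType A^c) :
  exists f : {additive tens_mod N (coind F M) ->
                       tens_mod (restr (conv_morph iota) N) M},
    injective f /\
    forall n k, f (tens _ _ n k) = \sum_i tens _ _ ((u i : A^c) *: n) (k i).
Proof.
have fB : balanced_mod A N (coind F M)
  (fun n k => \sum_i tens _ _ ((u i : A^c) *: n) (k i)
    : tens_mod (restr (conv_morph iota) N) M).
  split=> [n n' k|n k k'|n a k].
  - by rewrite -big_split /=; apply: eq_bigr => i _; rewrite scalerDr tensDl.
  - by rewrite -big_split /=; apply: eq_bigr => i _; rewrite coind_addE tensDr.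
  under [RHS]eq_bigr => i _ do rewrite coind_scaleE tens_sumr.
  rewrite exchange_big /=; apply: eq_bigr => j _.
  (* Expanding [a * u j] in the basis [u] gives coefficients in [S], which then cross the tensor
     sign. *)
  have -> : (u j : A^c) *: ((a : A^c) *: n) =
      \sum_i (F (t i * a * u j) : S^c) *:
        ((u i : A^c) *: n : restr (conv_morph iota) N).
    rewrite scalerA -[(u j : A^c) * a]/(a * u j : A).
    rewrite -(fr_uE F (a * u j)) scaler_suml.
    by apply: eq_bigr => i _; rewrite restr_scaleE scalerA mulrA.
  by rewrite tens_suml; apply: eq_bigr => i _; rewrite tensA.
have [f fE] := ex_tens_lift fB; exists f; split=> //.
(* The inverse sends n (x) m to n (x) (1 (x) m). *)
have gB : balanced_mod S (restr (conv_morph iota) N) M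
    (fun n m => tens _ _ (n : N) (coind_unit F m) : tens_mod N (coind F M)).
  split=> [n n' m|n m m'|n a m]; first exact: tensDl.
    by rewrite coind_unitD tensDr.
  by rewrite restr_scaleE tensA coind_unitZ.
have [g gE] := ex_tens_lift gB; apply: (can_inj (g := g)).
apply: tens_cancel => n k.
rewrite fE raddf_sum /=.
rewrite -[RHS](congr1 (tens _ _ n) (esym (coind_decomp k))) tens_sumr.
by apply: eq_bigr => i _; rewrite gE tensA.
Qed.

(** The comparison map of [coind_tens_restr] is natural in [N], so injectivity can be tested after
    restricting the right modules to [S], where [M] is flat. *)
Lemma coind_flat (M : lmodType S) : flat M -> flat (coind F M).
Proof.
move=> flM N N' f fI x y.
have [a [aI aE]] := coind_tens_restr M N.
have [b [_ bE]] := coind_tens_restr M N'.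
have [g [gE gT]] := ex_tens_mod_map (coind F M) f.
have [h [hE hT]] := @ex_tens_mod_map S M (restr (conv_morph iota) N)
  (restr (conv_morph iota) N') (restr_map (conv_morph iota) f).
have ab : b \o g =1 h \o a.
  apply: (tens_ext_eq (f := b \o g) (g := h \o a)) => n k /=.
  rewrite gT aE bE raddf_sum; apply: eq_bigr => i _.
  by rewrite hT; congr (tens _ _ _ _); apply/esym/(linearZ_LR f).
rewrite -!gE => /(congr1 b); rewrite [LHS]ab [RHS]ab /= !hE.
by move=> /(flM (restr (conv_morph iota) N) (restr (conv_morph iota) N')
  (restr_map (conv_morph iota) f) fI)/aI.
Qed.

(** Over the converse rings, [coind Fc N] is N (x)_S A; the map sends n (x) m to (n (x) 1) (x) m,
    with left inverse (n (x) t_i) (x) m |-> n (x) t_i m. *)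
Lemma restr_tens_coind (M : lmodType A) (N : lmodType S^c) :
  exists f : {additive tens_mod N (restr iota M) -> tens_mod (coind Fc N) M},
    injective f /\
    forall n m, f (tens _ _ n m) = tens _ _ (coind_unit Fc n) (m : M).
Proof.
have fB : balanced_mod S N (restr iota M)
  (fun n m => tens _ _ (coind_unit Fc n) (m : M) : tens_mod (coind Fc N) M).
  split=> [n n' m|n m m'|n a m].
  - by rewrite coind_unitD tensDl.
  - exact: tensDr.
  by rewrite coind_unitZ tensA.
have [f fE] := ex_tens_lift fB; exists f; split=> //.
have gB : balanced_mod A (coind Fc N) M
  (fun k m => \sum_i tens _ _ (k i) (t i *: m) : tens_mod N (restr iota M)).
  split=> [k k' m|k m m'|k a m].
  - by rewrite -big_split /=; apply: eq_bigr => i _;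
      rewrite (coind_addE (k : coind Fc N)) tensDl.
  - by rewrite -big_split /=; apply: eq_bigr => i _; rewrite scalerDr tensDr.
  under eq_bigr => i _ do rewrite coind_scaleE tens_suml.
  rewrite exchange_big /=; apply: eq_bigr => j _.
  have -> : t j *: (a *: m) =
      \sum_i F (t j * a * u i) *: (t i *: m : restr iota M).
    rewrite scalerA -{1}(fr_tE F (t j * a)) scaler_suml.
    by apply: eq_bigr => i _; rewrite restr_scaleE scalerA.
  rewrite tens_sumr; apply: eq_bigr => i _; rewrite -tensA.
  by rewrite -[t j * a * u i]mulrA.
have [g gE] := ex_tens_lift gB; apply: (can_inj (g := g)).
apply: tens_cancel => n m.
rewrite fE gE.
have mE : m = \sum_i F (u i) *: (t i *: m : restr iota M).
  rewrite -[LHS](scale1r (m : M)) -{1}(fr_tE F 1) scaler_suml.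
  by apply: eq_bigr => i _; rewrite restr_scaleE scalerA mul1r.
rewrite -[RHS](congr1 (tens _ _ n) (esym mE)) tens_sumr.
by apply: eq_bigr => i _; rewrite -tensA ffunE.
Qed.

(** By naturality of [restr_tens_coind] in [N], it suffices that [coind Fc] preserves injections and
    that [M] is flat over [A]. *)
Lemma restr_flat (M : lmodType A) : flat M -> flat (restr iota M).
Proof.
move=> flM N N' f fI x y.
have [a [aI aE]] := restr_tens_coind M N.
have [b [_ bE]] := restr_tens_coind M N'.
have [g [gE gT]] := ex_tens_mod_map (restr iota M) f.
have [h [hE hT]] :=
  @ex_tens_mod_map A M (coind Fc N) (coind Fc N') (coind_map Fc f).
have ab : b \o g =1 h \o a.
  apply: (tens_ext_eq (f := b \o g) (g := h \o a)) => n k /=.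
  rewrite gT aE bE hT; congr (tens _ _ _ _); apply/ffunP => i.
  by rewrite !ffunE; apply/esym/(linearZ_LR f).
rewrite -!gE => /(congr1 b); rewrite [LHS]ab [RHS]ab /= !hE.
by move=> /(flM (coind Fc N) (coind Fc N') (coind_map Fc f)
  (coind_map_inj fI))/aI.
Qed.

End Flat.

(* The separability element [\sum_p p.1 (x) p.2] splits the evaluation        *)
(* [A (x)_S M -> M] by [x |-> \sum_p p.1 (x) p.2 *: x].                       *)
Lemma retract_coind_restr (S A : pzRingType) (iota : {rmorphism S -> A})
    (F : frobenius iota) (M : lmodType A) :
  separable_ext iota -> retract M (coind F (restr iota M)).
Proof.
move=> /separable_extP [s [sC s1]].
pose U (m : M) : coind F (restr iota M) := coind_unit F (m : restr iota M).
have UD x y : U (x + y) = U x + U y := coind_unitD F (x : restr iota M) y.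
have UZ a x : U (iota a *: x) = iota a *: U x :=
  coind_unitZ F a (x : restr iota M).
have [r rE] := ex_linear (@coind_eval_linear _ _ _ F M _ idfun).
have rU m : r (U m) = m.
  rewrite rE -[RHS]scale1r -(fr_uE F 1) scaler_suml.
  by apply: eq_bigr => i _; rewrite ffunE restr_scaleE scalerA mulr1.
pose phi x (p : A * A) := p.1 *: U (p.2 *: x).
have sL : linear (fun x => \sum_(p <- s) phi x p).
  move=> a x y; rewrite scaler_sumr.
  under eq_bigr => p _ do rewrite /phi scalerDr UD scalerDr scalerA.
  rewrite big_split /=; congr (_ + _).
  (* For fixed [x], b (x) c |-> b (x) c x is well defined on A (x)_S A; applying it to the identity
     [sC a] gives [A]-linearity of the section. *)
  have fB : balanced (fun b s => b * iota s) (fun s b => iota s * b)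
      (fun b c : A => b *: U (c *: x)).
    split=> [b b' c|b c c'|b c d]; first by rewrite scalerDl.
      by rewrite scalerDl UD scalerDr.
    by rewrite -[(_ * _) *: x]scalerA UZ scalerA.
  have [f fE] := ex_tens_lift fB.
  have fs (g g' : A * A -> A) : f (\sum_(p <- s) tens _ _ (g p) (g' p)) =
      \sum_(p <- s) g p *: U (g' p *: x).
    by rewrite raddf_sum; apply: eq_bigr => p _; apply: fE.
  apply: etrans (esym (fs _ _)) (etrans (congr1 f (sC a)) _); rewrite fs.
  by apply: eq_bigr => p _; rewrite scalerA.
have [i iE] := ex_linear sL; exists i, r => x.
rewrite iE linear_sum -[RHS]scale1r -s1 scaler_suml.
by apply: eq_bigr => p _; rewrite linearZ /= rU scalerA.
Qed.

(** * The skew group ring of G as a Frobenius extension of that of H *)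

Section SkewFrobenius.
Variables (G : finGroupType) (R : pzRingType) (act : ring_action G R).
Variable H : {group G}.
Local Notation A := (skew_ring act).
Local Notation S := (skew_ring (res_action act H)).
Local Notation incl := (skew_incl act H).

Definition skew_proj (f : A) : S := [ffun h => f (sgval h)].

Fact skew_proj_zmod : zmod_morphism skew_proj.
Proof. by move=> f k; apply/ffunP => h; rewrite !ffunE. Qed.

HB.instance Definition _ :=
  GRing.isZmodMorphism.Build _ _ skew_proj skew_proj_zmod.

Lemma skew_incl_notin (s : S) g : g \notin H -> incl s g = 0.
Proof. by move=> /negPf gH; rewrite ffunE gH. Qed.

Lemma skew_incl_proj f g : incl (skew_proj f) g = if g \in H then f g else 0.
Proof. by rewrite ffunE; case: ifP => // gH; rewrite ffunE subgK. Qed.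

Lemma skew_mulE (f k : A) x : (f * k) x = \sum_y f y * act y (k (y^-1 * x)%g).
Proof. by rewrite ffunE. Qed.

(** Multiplication by an element supported on [H] preserves both the functions supported on [H] and
    those vanishing on [H]. *)
Lemma skew_projMl (s : S) f : skew_proj (incl s * f) = s * skew_proj f.
Proof.
apply: skew_incl_inj; rewrite rmorphM; apply/ffunP => x.
rewrite skew_incl_proj !skew_mulE; case: ifPn => xH.
  apply: eq_bigr => y _; have [yH|yH] := boolP (y \in H).
    by rewrite skew_incl_proj groupMl ?groupV // xH.
  by rewrite skew_incl_notin // !mul0r.
rewrite big1 // => y _; have [yH|yH] := boolP (y \in H).
  by rewrite skew_incl_proj groupMl ?groupV // (negPf xH) rmorph0 mulr0.
by rewrite skew_incl_notin // !mul0r.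
Qed.

Lemma skew_projMr f (s : S) : skew_proj (f * incl s) = skew_proj f * s.
Proof.
apply: skew_incl_inj; rewrite rmorphM; apply/ffunP => x.
rewrite skew_incl_proj !skew_mulE; case: ifPn => xH.
  apply: eq_bigr => y _; rewrite skew_incl_proj; case: ifPn => // yH.
  by rewrite skew_incl_notin ?rmorph0 ?mulr0 ?mul0r // groupMr // groupV.
rewrite big1 // => y _; rewrite skew_incl_proj; case: ifPn => [yH|];
  last by rewrite mul0r.
by rewrite skew_incl_notin ?rmorph0 ?mulr0 // groupMl // groupV.
Qed.

Lemma skew_mul_monom (f : A) g x : (f * monom act 1 g) x = f (x * g^-1)%g.
Proof.
rewrite skew_mulE (bigD1 (x * g^-1)%g) //= invMg invgK mulgKV ffunE eqxx.
rewrite rmorph1 mulr1 big1 ?addr0 // => y yx.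
rewrite ffunE ifF ?rmorph0 ?mulr0 //.
apply/negP => /eqP yg; case/eqP: yx.
by rewrite -yg invMg invgK mulKVg.
Qed.

Lemma monom_skew_mul (f : A) g x :
  (monom act 1 g * f) x = act g (f (g^-1 * x)%g).
Proof.
rewrite skew_mulE (bigD1 g) //= ffunE eqxx mul1r.
by rewrite big1 ?addr0 // => y /negPf yg; rewrite ffunE yg mul0r.
Qed.

(** The canonical representatives form a finite type with exactly one element in each right coset of
    [H]. *)
Definition rcoset_rep := {g : G | repr (H :* g)%g == g}.

Lemma rcoset_rep_eq (x : G) (i : rcoset_rep) :
  ((x * (val i)^-1)%g \in H) = (val i == repr (H :* x)%g).
Proof.
rewrite -mem_rcoset; apply/idP/eqP => [xi|->]; last first.
  by rewrite rcoset_repr rcoset_refl.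
by rewrite (rcoset_eqP xi) (eqP (valP i)).
Qed.

(** Only the representative of the coset of [x] contributes; both basis expansions reduce to
    this. *)
Lemma sum_rcoset_rep (x : G) (r : R) :
  \sum_(i : rcoset_rep) (if (x * (val i)^-1)%g \in H then r else 0) = r.
Proof.
have xP : repr (H :* repr (H :* x))%g == repr (H :* x)%g by rewrite rcoset_repr.
pose j : rcoset_rep := exist (fun g => is_true (repr (H :* g)%g == g)) _ xP.
rewrite (bigD1 j) // rcoset_rep_eq eqxx big1 /= ?addr0 // => i ix.
by rewrite rcoset_rep_eq ifF // -(negPf ix); apply/esym/val_eqE.
Qed.

Lemma skew_proj_Gram (i j : rcoset_rep) :
  skew_proj (monom act 1 (val i) * monom act 1 (val j)^-1) = (i == j)%:R.
Proof.
rewrite monomM rmorph1 mulr1; have [<-|ij] := eqVneq i j; apply/ffunP => h.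
  by rewrite mulgV !ffunE -(inj_eq subg_inj).
rewrite !ffunE; case: eqP => // hE; case/eqP: ij; apply/val_inj/eqP.
by rewrite -(eqP (valP i)) eq_sym -rcoset_rep_eq -hE subgP.
Qed.

Definition skew_frobenius : frobenius incl.
Proof.
apply: (@Frobenius _ _ incl rcoset_rep skew_proj
  (fun i => monom act 1 (val i)) (fun i => monom act 1 (val i)^-1)).
- exact: skew_projMl.
- exact: skew_projMr.
- exact: skew_proj_Gram.
(* The term at [i] is the part of [f] supported on the right coset of [val i]. *)
- move=> f; apply/ffunP => x; rewrite sum_ffunE -[RHS](sum_rcoset_rep x).
  apply: eq_bigr => i _; rewrite skew_mul_monom skew_incl_proj skew_mul_monom.
  by rewrite invgK mulgKV.
(* The inverses represent the left cosets, so the coset sum is taken at [x^-1]. *)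
- move=> f; apply/ffunP => x; rewrite sum_ffunE -[RHS](sum_rcoset_rep x^-1).
  apply: eq_bigr => i _; rewrite monom_skew_mul skew_incl_proj monom_skew_mul.
  rewrite invgK mulKg -invMg groupV; case: ifP; rewrite ?rmorph0 // => _.
  by rewrite -ractM mulVg ract1.
Defined.

End SkewFrobenius.

(** * Transfer of n-perfectness between the two skew group rings *)

Theorem proposition2p3 (R : pzRingType) (G : finGroupType)
    (act : ring_action G R) (H : {group G}) (n : nat) :
  (left_perfect n (skew_ring act) -> left_perfect n (skew_ring (res_action act H))) /\
  (separable_ext (skew_incl act H) ->
   (left_perfect n (skew_ring act) <-> left_perfect n (skew_ring (res_action act H)))).
Proof.
pose F := skew_frobenius act H.
have down : left_perfect n (skew_ring act) ->
    left_perfect n (skew_ring (res_action act H)).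
  move=> pA M /(@coind_flat _ _ _ F)/pA/proj_dim_leP/(@restr_pd_le _ _ _ F) dM.
  apply/proj_dim_leP/(pd_le_retract _ dM)/retract_restr_coind.
  (* The condition [F 1 = 1]: restricting the identity of RG to [H] gives the identity of RH. *)
  by apply/ffunP => h; rewrite !ffunE -(inj_eq subg_inj).
split=> // sep; split=> // pS M.
move=> /(@restr_flat _ _ _ F)/pS/proj_dim_leP/(@coind_pd_le _ _ _ F) dM.
exact/proj_dim_leP/(pd_le_retract _ dM)/retract_coind_restr.
Qed.
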